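(* Let $\mathcal{G}$ be a set of positions closed under options, and let $A\in\{\mathbb{Z},\mathbb{D}\}$. Suppose $\mathcal{G}$ is partitioned into disjoint sets $\mathcal{D}$ and $\mathcal{S}$ such that (a) every $G\in\mathcal{D}$ has the $\Diamond_A$-property, and (b) for every $G\in\mathcal{S}$, all Left options and all Right options of $G$ belong to $\mathcal{D}$. Then (1) every $G\in\mathcal{G}$ satisfies $G\in\{A\mid A\}$, and (2) every $G\in\mathcal{D}$ satisfies $G\in A$.
   Context: Positions are short (finite, loop-free) combinatorial games $G=\{G^{\mathcal L}\mid G^{\mathcal R}\}$ with finite sets of Left/Right options; $G^L$, $G^R$ denote individual options. A set of positions is closed under options if every Left or Right option of a member is again a member. The relations $=,\le,<$ are the usual ones for games; $G\ngeq H$ means ''$G<H$ or $G$ is fuzzy with $H$''. $\mathbb{Z}$ and $\mathbb{D}$ (dyadic rationals) are viewed as games. For $A\in\{\mathbb{Z},\mathbb{D}\}$, ''$G\in A$'' means $G$ equals some element of $A$, and $\{A\mid A\}$ is the set of positions equal to $\{a\mid b\}$ for some $a,b\in A$. The $A$-stops: $\mathrm{LS}_A(G)=\mathrm{RS}_A(G)=$ the element of $A$ equal to $G$ if $G\in A$; otherwise $\mathrm{LS}_A(G)=\max_{G^L}\mathrm{RS}_A(G^L)$, $\mathrm{RS}_A(G)=\min_{G^R}\mathrm{LS}_A(G^R)$. Guide options: $\mathrm{gd}^L_A(G)=\emptyset$ if $G\in A$; if $G\notin A$ and some Left option equals $\mathrm{LS}_A(G)$, then $\mathrm{gd}^L_A(G)=\{G^L:G^L=\mathrm{LS}_A(G)\}$;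 otherwise $\mathrm{gd}^L_A(G)=\{G^L:\mathrm{RS}_A(G^L)=\mathrm{LS}_A(G)\}$. Dually $\mathrm{gd}^R_A(G)=\emptyset$ if $G\in A$; if $G\notin A$ and some Right option equals $\mathrm{RS}_A(G)$ then $\mathrm{gd}^R_A(G)=\{G^R:G^R=\mathrm{RS}_A(G)\}$; otherwise $\mathrm{gd}^R_A(G)=\{G^R:\mathrm{LS}_A(G^R)=\mathrm{RS}_A(G)\}$. $G$ has the $\Diamond_A$-property if $G\in A$, or there exist $G^L\in\mathrm{gd}^L_A(G)$, $G^R\in\mathrm{gd}^R_A(G)$, $x\in A$ with $G^L\ngeq x$ and $x\ngeq G^R$. *)

(* Defs.v *)
From HB Require Import structures.
From mathcomp Require Import all_boot all_order all_algebra.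
From mathcomp Require Import boolp classical_sets.

Set Implicit Arguments.
Unset Strict Implicit.
Unset Printing Implicit Defensive.

Import Order.TTheory GRing.Theory Num.Theory.
Local Open Scope classical_set_scope.
Local Open Scope ring_scope.

(* The finite sets of options are represented by lists. Only membership in
   these lists is ever used: order and repetition of options are irrelevant. *)
Inductive game : Type := Game of seq game & seq game.

HB.instance Definition _ := gen_eqMixin game.
HB.instance Definition _ := gen_choiceMixin game.

Definition lopts (G : game) : seq game := let: Game Ls _ := G in Ls.
Definition ropts (G : game) : seq game := let: Game _ Rs := G in Rs.

(* [cmp G H] is the pair of truth values of G <= H and H <= G. The two are
   computed together so that the recursion is structural (outer on G, inner
   on H); [legE] below is the resulting recursion for <= alone. *)
Fixpoint cmp (G : game) : game -> bool * bool :=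
  fix cmpG (H : game) : bool * bool :=
    let: Game GLs GRs := G in
    let: Game HLs HRs := H in
    (all (fun GL => ~~ (cmp GL H).2) GLs && all (fun HR => ~~ (cmpG HR).2) HRs,
     all (fun HL => ~~ (cmpG HL).1) HLs && all (fun GR => ~~ (cmp GR H).1) GRs).

Lemma game_nested_ind (P : game -> Prop) :
  (forall Ls Rs, {in Ls, forall G, P G} -> {in Rs, forall G, P G} ->
     P (Game Ls Rs)) ->
  forall G, P G.
Proof.
move=> IH; fix game_ih 1 => -[Ls Rs]; apply: IH.
- elim: Ls => [G|L Ls IHLs G]; first by rewrite in_nil; discriminate.
  rewrite inE => /orP[/eqP->|GLs]; [exact: game_ih | exact: IHLs].
- elim: Rs => [G|R Rs IHRs G]; first by rewrite in_nil; discriminate.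
  rewrite inE => /orP[/eqP->|GRs]; [exact: game_ih | exact: IHRs].
Qed.

Definition leg (G H : game) : bool := (cmp G H).1.

Lemma cmpE (G H : game) : cmp G H =
  (all (fun GL => ~~ (cmp GL H).2) (lopts G) &&
     all (fun HR => ~~ (cmp G HR).2) (ropts H),
   all (fun HL => ~~ (cmp G HL).1) (lopts H) &&
     all (fun GR => ~~ (cmp GR H).1) (ropts G)).
Proof. by case: G H => [? ?] [? ?]. Qed.

Lemma cmp_swap (G H : game) : cmp H G = ((cmp G H).2, (cmp G H).1).
Proof.
elim/game_nested_ind: G H => GLs GRs IHGL IHGR.
elim/game_nested_ind => HLs HRs IHHL IHHR; rewrite !cmpE /lopts /ropts /fst /snd.
congr ((_ && _), (_ && _)); apply: eq_in_all => K.
- by move/IHHL => ->.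
- by move/IHGR => ->.
- by move/IHGL => ->.
- by move/IHHR => ->.
Qed.

Lemma legE (G H : game) :
  leg G H = all (fun GL => ~~ leg H GL) (lopts G) &&
            all (fun HR => ~~ leg HR G) (ropts H).
Proof.
rewrite /leg cmpE /fst; congr (_ && _); apply: eq_all => K.
- by rewrite [cmp H K]cmp_swap.
- by rewrite [cmp K G]cmp_swap.
Qed.

Definition eqg (G H : game) : bool := leg G H && leg H G.
Definition ltg (G H : game) : bool := leg G H && ~~ leg H G.
Definition fuzzyg (G H : game) : bool := ~~ leg G H && ~~ leg H G.
Definition ngeg (G H : game) : bool := ltg G H || fuzzyg G H.

Definition zero_game : game := Game [::] [::].

Definition int_game (m : int) : game :=
  match m with
  | Posz n => iter n (fun g => Game [:: g] [::]) zero_game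
  | Negz n => iter n.+1 (fun g => Game [::] [:: g]) zero_game
  end.

(* The game of m / 2 ^ k: for m odd and 0 < k, it is
   { (m - 1) / 2 ^ k | (m + 1) / 2 ^ k }, where both options are reduced to
   the denominator 2 ^ (k - 1). *)
Fixpoint dyadic_game (m : int) (k : nat) : game :=
  if k is k'.+1 then
    if (2 %| m)%Z then dyadic_game (m %/ 2)%Z k'
    else Game [:: dyadic_game (m %/ 2)%Z k']
              [:: dyadic_game ((m %/ 2)%Z + 1) k']
  else int_game m.

(* Meaningful for dyadic q only, whose reduced denominator is
   2 ^ logn 2 (denq q). *)
Definition rat_game (q : rat) : game :=
  dyadic_game (numq q) (logn 2 `|denq q|%N).

Definition integers : set rat := [set q | exists m : int, q = m%:~R].
Definition dyadics : set rat :=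
  [set q | exists (m : int) (k : nat), q = m%:~R / 2 ^+ k].

Definition in_num (A : set rat) (G : game) : Prop :=
  exists2 a, A a & eqg G (rat_game a).

Definition in_switch (A : set rat) (G : game) : Prop :=
  exists a b, [/\ A a, A b & eqg G (Game [:: rat_game a] [:: rat_game b])].

(* The default value 0 of the three operations below is never used by [stops]:
   [num_value] is called only on games equal to an element of A, and a game
   without Left options, or without Right options, equals an integer. *)
Definition num_value (A : set rat) (G : game) : rat :=
  xget 0 [set a | A a /\ eqg G (rat_game a)].
Definition seq_max (s : seq rat) : rat := \big[Num.max/head 0 s]_(x <- s) x.
Definition seq_min (s : seq rat) : rat := \big[Num.min/head 0 s]_(x <- s) x.

(* The pair of the Left stop and the Right stop. *)
Fixpoint stops (A : set rat) (G : game) : rat * rat :=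
  if `[< in_num A G >] then (num_value A G, num_value A G) else
  let: Game Ls Rs := G in
  (seq_max [seq (stops A GL).2 | GL <- Ls],
   seq_min [seq (stops A GR).1 | GR <- Rs]).

Definition LS (A : set rat) (G : game) : rat := (stops A G).1.
Definition RS (A : set rat) (G : game) : rat := (stops A G).2.

Definition gdL (A : set rat) (G : game) : seq game :=
  if `[< in_num A G >] then [::] else
  if has (fun GL => eqg GL (rat_game (LS A G))) (lopts G)
  then [seq GL <- lopts G | eqg GL (rat_game (LS A G))]
  else [seq GL <- lopts G | RS A GL == LS A G].

Definition gdR (A : set rat) (G : game) : seq game :=
  if `[< in_num A G >] then [::] else
  if has (fun GR => eqg GR (rat_game (RS A G))) (ropts G)
  then [seq GR <- ropts G | eqg GR (rat_game (RS A G))]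
  else [seq GR <- ropts G | LS A GR == RS A G].

Definition diamond (A : set rat) (G : game) : Prop :=
  in_num A G \/
  exists GL GR x, [/\ GL \in gdL A G, GR \in gdR A G, A x,
    ngeg GL (rat_game x) & ngeg (rat_game x) GR].

Definition option_closed (P : set game) : Prop :=
  forall G, P G -> (forall GL, GL \in lopts G -> P GL) /\
                   (forall GR, GR \in ropts G -> P GR).

(* Main.v *)
(* The theorem goes by induction on G. If all options of G lie in A, then G is
   {max | min} of its options. If G has the diamond property and is not in A,
   the point is that the x of that property satisfies G^L <| x <| G^R for all
   options and not only for the guide options, so that the simplicity theorem
   puts G in A after all. This rests on comparing a game H with an x in A
   through its stops: RS H < x implies H <| x, x < RS H implies x <= H, and the
   dual statements. When RS H = x the stops do not decide in general, but they
   do if H is a switch {a | b} outside A: then x <= H would give x < b and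
   hence y <= H for some y strictly between x and b, contradicting
   RS H = x < y. For A the integers this y is a half-integer, so the comparison
   with stops is proved for every dyadic y whose canonical options lie in A. *)
Require Import Defs.
From mathcomp Require Import all_boot all_order all_algebra.
From mathcomp Require Import boolp classical_sets.
From mathcomp Require Import zify lra.

Set Implicit Arguments.
Unset Strict Implicit.

Import Order.TTheory GRing.Theory Num.Theory.
Local Open Scope classical_set_scope.
Local Open Scope ring_scope.

(** * Order on games *)

Lemma game_option_ind (P : game -> Prop) :
  (forall G, {in lopts G, forall K, P K} -> {in ropts G, forall K, P K} ->
     P G) ->
  forall G, P G.
Proof. by move=> IH; elim/game_nested_ind => Ls Rs IHL IHR; apply: IH. Qed.

Lemma legP (G H : game) :
  reflect ({in lopts G, forall GL, ~~ leg H GL} /\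
           {in ropts H, forall HR, ~~ leg HR G}) (leg G H).
Proof.
rewrite legE; apply: (iffP andP) => -[/allP hL /allP hR]; split => //;
by apply/allP.
Qed.

Lemma leg_lopt {G H GL : game} : leg G H -> GL \in lopts G -> ~~ leg H GL.
Proof. by case/legP => hL _; apply: hL. Qed.

Lemma leg_ropt {G H HR : game} : leg G H -> HR \in ropts H -> ~~ leg HR G.
Proof. by case/legP => _ hR; apply: hR. Qed.

Lemma leg_refl (G : game) : leg G G.
Proof.
elim/game_option_ind: G => G IHL IHR; apply/legP; split => K hK; apply/negP.
- by move/leg_lopt => /(_ _ hK); rewrite IHL.
- by move/leg_ropt => /(_ _ hK); rewrite IHR.
Qed.

(* The induction proves transitivity for all cyclic rotations of the triple at
   once, since the step from (G, H, K) uses (H, K, G^L) and (K^R, G, H). *)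
Lemma leg_trans {H G K : game} : leg G H -> leg H K -> leg G K.
Proof.
pose T G H K := leg G H -> leg H K -> leg G K.
suff: T G H K /\ T H K G /\ T K G H by case=> hT _; exact: hT.
have step G' H' K' : {in lopts G', forall GL, T H' K' GL} ->
    {in ropts K', forall KR, T KR G' H'} -> T G' H' K'.
  move=> hL hR leGH leHK; apply/legP; split => O hO; apply/negP => le.
  - by move: (leg_lopt leGH hO); rewrite (hL _ hO leHK le).
  - by move: (leg_ropt leHK hO); rewrite (hR _ hO le leGH).
elim/game_option_ind: G H K => G IGL IGR.
elim/game_option_ind => H IHL IHR; elim/game_option_ind => K IKL IKR.
split; [|split]; apply: step => O hO.
- by case: (IGL _ hO H K) => _ [].
- by case: (IKR _ hO) => _ [].
- by case: (IHL _ hO K) => _ [].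
- by case: (IGR _ hO H K).
- by case: (IKL _ hO).
- by case: (IHR _ hO K) => _ [].
Qed.

Lemma lopt_nle (G GL : game) : GL \in lopts G -> ~~ leg G GL.
Proof. exact: leg_lopt (leg_refl G). Qed.

Lemma ropt_nle (G GR : game) : GR \in ropts G -> ~~ leg GR G.
Proof. exact: leg_ropt (leg_refl G). Qed.

Lemma eqg_trans (H G K : game) : eqg G H -> eqg H K -> eqg G K.
Proof.
move=> /andP[GH HG] /andP[HK KH].
by rewrite /eqg (leg_trans GH HK) (leg_trans KH HG).
Qed.

Lemma ngegE (G H : game) : ngeg G H = ~~ leg H G.
Proof. by rewrite /ngeg /ltg /fuzzyg; case: leg; case: leg. Qed.

(** A Left option of [G] lying above [H] would put [H] below one of its own Left options; dually on
    the right. *)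
Lemma leg_dominated (G H : game) :
  (forall GL, GL \in lopts G -> exists2 HL, HL \in lopts H & leg GL HL) ->
  (forall HR, HR \in ropts H -> exists2 GR, GR \in ropts G & leg GR HR) ->
  leg G H.
Proof.
move=> hL hR; apply/legP; split => K hK; apply/negP => le.
- have [HL hHL leK] := hL _ hK.
  by move: (lopt_nle hHL); rewrite (leg_trans le leK).
- have [GR hGR leK] := hR _ hK.
  by move: (ropt_nle hGR); rewrite (leg_trans leK le).
Qed.

(** * Canonical forms of integers and dyadic rationals *)

Lemma int_game_pos (n : nat) :
  int_game n.+1%:Z = Game [:: int_game n%:Z] [::].
Proof. by []. Qed.

Lemma int_game_neg (n : nat) :
  int_game (- n.+1%:Z) = Game [::] [:: int_game (- n%:Z)].
Proof. by case: n. Qed.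

Lemma rat_game_int (n : int) : rat_game n%:~R = int_game n.
Proof. by rewrite /rat_game numq_int denq_int logn1. Qed.

(** Frees [rat_game] from the reduced denominator: [dyadic_game] halves even numerators, so every
    fraction representing the same rational yields the same game. *)
Lemma dyadic_gameE (m : int) (k : nat) :
  dyadic_game m k = rat_game (m%:~R / 2 ^+ k).
Proof.
elim: k m => [|k IH] m; first by rewrite expr0 divr1 rat_game_int.
case: (boolP (2 %| m)%Z) => m2.
  rewrite /= m2 IH; congr rat_game.
  rewrite -{2}(divzK m2) intrM exprS invfM mulrACA.
  by rewrite mulrA mulfK.
(* An odd numerator makes the fraction reduced, so [numq] and [denq] can be read off. *)
have cop : coprime `|m|%N `|2 ^+ k.+1 : int|%N.
  rewrite abszX coprimeXr // coprime_sym prime_coprime //.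
have -> : (m%:~R / 2 ^+ k.+1 : rat) = m%:~R / (2 ^+ k.+1 : int)%:~R.
  by rewrite rmorphXn.
rewrite /rat_game coprimeq_num // coprimeq_den //.
rewrite gtr0_sg ?exprn_gt0 // mul1r expf_eq0 /=.
by rewrite !abszX pfactorK //= (negbTE m2).
Qed.

Lemma rat_game_odd (m : int) (k : nat) :
  rat_game ((2 * m + 1)%:~R / 2 ^+ k.+1) =
  Game [:: rat_game (m%:~R / 2 ^+ k)] [:: rat_game ((m + 1)%:~R / 2 ^+ k)].
Proof.
rewrite -!dyadic_gameE /=.
have -> : (2 %| 2 * m + 1)%Z = false by lia.
by have -> : ((2 * m + 1) %/ 2)%Z = m by lia.
Qed.

Lemma dyadic_cases (x : rat) : dyadics x ->
  (exists n : int, x = n%:~R) \/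
  (exists (m : int) (k : nat), x = (2 * m + 1)%:~R / 2 ^+ k.+1).
Proof.
case=> m [k ->]; elim: k m => [|k IH] m.
  by left; exists m; rewrite expr0 divr1.
case: (boolP (2 %| m)%Z) => m2.
  have -> : m%:~R / 2 ^+ k.+1 = (m %/ 2)%Z%:~R / 2 ^+ k :> rat.
    by rewrite -{1}(divzK m2) intrM exprS invfM mulrACA mulrA mulfK.
  exact: IH.
right; exists (m %/ 2)%Z, k; congr (_%:~R / _); lia.
Qed.

Lemma int_dyadic (n : int) : dyadics n%:~R.
Proof. by exists n, 0%N; rewrite expr0 divr1. Qed.

Lemma int_game_lopt (n : int) (XL : game) :
  XL \in lopts (int_game n) -> 0 < n /\ XL = int_game (n - 1).
Proof.
case: n => [[|n]|n] //; rewrite int_game_pos inE => /eqP ->; split => //.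
by congr int_game; lia.
Qed.

Lemma int_game_ropt (n : int) (XR : game) :
  XR \in ropts (int_game n) -> n < 0 /\ XR = int_game (n + 1).
Proof.
case: n => [[|n]|n] //; rewrite NegzE int_game_neg inE => /eqP ->; split => //.
by congr int_game; lia.
Qed.

Lemma dyadic_lt_step (m : int) (k : nat) :
  m%:~R / 2 ^+ k < ((2 * m + 1)%:~R / 2 ^+ k.+1 : rat) < (m + 1)%:~R / 2 ^+ k.
Proof.
have h : 0 < (2 ^+ k : rat)^-1 by rewrite invr_gt0 exprn_gt0.
rewrite exprS invfM !intrD intrM; set u := _^-1 in h *.
by apply/andP; split; lra.
Qed.

Lemma dyadic_lift (c : int) (j k : nat) : (j <= k)%N ->
  exists d : int, c%:~R / 2 ^+ j = d%:~R / 2 ^+ k :> rat.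
Proof.
move=> jk; exists (c * 2 ^+ (k - j)).
apply/eqP; rewrite eqr_div ?expf_neq0 // intrM rmorphXn /=.
by rewrite -mulrA -exprD subnK.
Qed.

Lemma ltr_dyadic (c d : int) (k : nat) :
  (c%:~R / 2 ^+ k < d%:~R / 2 ^+ k :> rat) = (c < d).
Proof. by rewrite ltr_pM2r ?ltr_int // invr_gt0 exprn_gt0. Qed.

Lemma dyadic_half (m : int) (k : nat) :
  m%:~R / 2 ^+ k = (2 * m)%:~R / 2 ^+ k.+1 :> rat.
Proof. by rewrite intrM exprS invfM mulrACA mulfV // mul1r. Qed.

(** The number with the larger reduced denominator has an option on the way to the other number,
    possibly equal to it; between integers the signs decide. Such an option refutes
    [leg (rat_game y) (rat_game x)] in [leg_rat]. *)
Lemma dyadic_sep (x y : rat) : dyadics x -> dyadics y -> x < y ->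
  (exists a, [/\ dyadics a, x <= a & rat_game a \in lopts (rat_game y)]) \/
  (exists a, [/\ dyadics a, a <= y & rat_game a \in ropts (rat_game x)]).
Proof.
have odd_left m k x' : (exists c j, x' = c%:~R / 2 ^+ j /\ (j <= k.+1)%N) ->
    x' < (2 * m + 1)%:~R / 2 ^+ k.+1 ->
    exists a, [/\ dyadics a, x' <= a &
      rat_game a \in lopts (rat_game ((2 * m + 1)%:~R / 2 ^+ k.+1))].
  case=> c [j [-> /(dyadic_lift c)[d ->]]]; rewrite ltr_dyadic => lt.
  exists (m%:~R / 2 ^+ k); rewrite rat_game_odd mem_head; split=> //.
    by exists m, k.
  (* Over the denominator [2 ^ k.+1] the chosen option has numerator [2 * m], and [d < 2 * m + 1]
     means [d <= 2 * m]. *)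
  by rewrite (dyadic_half m) leNgt ltr_dyadic -leNgt; lia.
have odd_right m k y' : (exists c j, y' = c%:~R / 2 ^+ j /\ (j <= k.+1)%N) ->
    (2 * m + 1)%:~R / 2 ^+ k.+1 < y' ->
    exists a, [/\ dyadics a, a <= y' &
      rat_game a \in ropts (rat_game ((2 * m + 1)%:~R / 2 ^+ k.+1))].
  case=> c [j [-> /(dyadic_lift c)[d ->]]]; rewrite ltr_dyadic => lt.
  exists ((m + 1)%:~R / 2 ^+ k); rewrite rat_game_odd mem_head; split=> //.
    by exists (m + 1), k.
  by rewrite (dyadic_half (m + 1)) leNgt ltr_dyadic -leNgt; lia.
move=> /dyadic_cases[[n ->]|[m [k ->]]] /dyadic_cases[[p ->]|[q [l ->]]] lt.
(* A positive [p] has the Left option [p - 1]; otherwise [n < p <= 0], and the negative [n] has the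
   Right option [n + 1]. *)
- rewrite ltr_int in lt; case: (ltP 0 p) => p0.
    left; exists (p - 1)%:~R; rewrite ler_int; split; [exact: int_dyadic|lia|].
    rewrite !rat_game_int; case: p p0 lt => [[|p]|p] // _ _.
    by rewrite int_game_pos inE; apply/eqP; congr int_game; lia.
  right; exists (n + 1)%:~R; rewrite ler_int; split; [exact: int_dyadic|lia|].
  have : n < 0 by lia.
  rewrite !rat_game_int; case: n lt => [[|n]|n] // _ _.
  by rewrite NegzE int_game_neg inE; apply/eqP; congr int_game; lia.
- by left; apply: odd_left => //; exists n, 0%N; rewrite expr0 divr1.
- by right; apply: odd_right => //; exists p, 0%N; rewrite expr0 divr1.
- case: (leqP k l) => kl.
    by left; apply: odd_left => //; exists (2 * m + 1), k.+1.
  by right; apply: odd_right => //; exists (2 * q + 1), l.+1; split=> //; lia.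
Qed.

(** * Options of numbers in [A] *)

Section NumberSets.

Variable A : set rat.
Hypothesis hA : A = integers \/ A = dyadics.

Lemma num_dyadic (x : rat) : A x -> dyadics x.
Proof. by case: hA => -> // -[n ->]; apply: int_dyadic. Qed.

Lemma int_num (n : int) : A n%:~R.
Proof. by case: hA => ->; [exists n | apply: int_dyadic]. Qed.

Lemma num_cases (x : rat) : A x ->
  (exists n : int, x = n%:~R) \/
  (A = dyadics /\
   exists (m : int) (k : nat), x = (2 * m + 1)%:~R / 2 ^+ k.+1).
Proof.
move=> Ax; have [|ex] := dyadic_cases (num_dyadic Ax); first by left.
case: hA Ax => eA; last by right.
by rewrite eA => -[n ->]; left; exists n.
Qed.

Lemma num_lopt (x : rat) (XL : game) : A x -> XL \in lopts (rat_game x) ->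
  exists a, [/\ A a, a < x & XL = rat_game a].
Proof.
case/num_cases => [[n ->]|[-> [m [k ->]]]].
  rewrite rat_game_int => /int_game_lopt[_ ->]; exists (n - 1)%:~R.
  by rewrite rat_game_int ltr_int; split=> //; [apply: int_num | lia].
rewrite rat_game_odd inE => /eqP ->; exists (m%:~R / 2 ^+ k); split=> //.
- by exists m, k.
- by case/andP: (dyadic_lt_step m k).
Qed.

Lemma num_ropt (x : rat) (XR : game) : A x -> XR \in ropts (rat_game x) ->
  exists a, [/\ A a, x < a & XR = rat_game a].
Proof.
case/num_cases => [[n ->]|[-> [m [k ->]]]].
  rewrite rat_game_int => /int_game_ropt[_ ->]; exists (n + 1)%:~R.
  by rewrite rat_game_int ltr_int; split=> //; [apply: int_num | lia].
rewrite rat_game_odd inE => /eqP ->; exists ((m + 1)%:~R / 2 ^+ k); split=> //.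
- by exists (m + 1), k.
- by case/andP: (dyadic_lt_step m k).
Qed.

End NumberSets.

(** * Comparison of dyadic games, and integer bounds of a game *)

Lemma leg_rat (x y : rat) : dyadics x -> dyadics y ->
  leg (rat_game x) (rat_game y) = (x <= y).
Proof.
have numL a XL : dyadics a -> XL \in lopts (rat_game a) ->
    exists b, [/\ dyadics b, b < a & XL = rat_game b] by apply: num_lopt; right.
have numR a XR : dyadics a -> XR \in ropts (rat_game a) ->
    exists b, [/\ dyadics b, a < b & XR = rat_game b] by apply: num_ropt; right.
have step a b : dyadics a -> dyadics b ->
    (forall c, dyadics c -> rat_game c \in lopts (rat_game a) ->
       leg (rat_game b) (rat_game c) = (b <= c)) ->
    (forall c, dyadics c -> rat_game c \in ropts (rat_game b) ->
       leg (rat_game c) (rat_game a) = (c <= a)) ->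
    leg (rat_game a) (rat_game b) = (a <= b).
  move=> Da Db hL hR; case: (leP a b) => ab.
    apply/legP; split=> K hK.
      have [c [Dc ca eK]] := numL _ _ Da hK.
      by rewrite eK hL -?eK // -ltNge; apply: lt_le_trans ab.
    have [c [Dc bc eK]] := numR _ _ Db hK.
    by rewrite eK hR -?eK // -ltNge; apply: le_lt_trans bc.
  apply/negP => le; have [[c [Dc bc hc]]|[c [Dc ca hc]]] := dyadic_sep Db Da ab.
  - by move: (leg_lopt le hc); rewrite hL ?bc.
  - by move: (leg_ropt le hc); rewrite hR ?ca.
(* Passing to options exchanges the two sides of a comparison, so one induction on pairs of games
   carries both directions. *)
pose C (X Y : game) := forall a b, dyadics a -> dyadics b ->
  X = rat_game a -> Y = rat_game b ->
  leg X Y = (a <= b) /\ leg Y X = (b <= a).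
suff hC X Y : C X Y by move=> Dx Dy; case: (hC _ _ _ _ Dx Dy erefl erefl).
elim/game_option_ind: X Y => X IXL IXR.
elim/game_option_ind => Y IYL IYR a b Da Db eX eY; rewrite {1 2}eX {1 2}eY.
split; apply: step => // c Dc hc; rewrite -?eX -?eY in hc *.
- by case: (IXL _ hc Y c b).
- by case: (IYR _ hc a c).
- by case: (IYL _ hc a c).
- by case: (IXR _ hc Y c b).
Qed.

Lemma leg_int_ub (G : game) : exists n : nat, leg G (rat_game n%:R).
Proof.
elim/game_option_ind: G => G IHL _.
have Dn (n : nat) : dyadics n%:R by exact: (int_dyadic n).
have [n hn] : exists n : nat, {in lopts G, forall GL, leg GL (rat_game n%:R)}.
  elim: (lopts G) IHL => [|K s IHs] IHL; first by exists 0%N.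
  have [n hn] := IHL K (mem_head K s).
  have [|m hm] := IHs; first by move=> L Ls; apply: IHL; rewrite inE Ls orbT.
  exists (maxn n m) => L; rewrite inE => /orP[/eqP->|/hm le].
    by apply: leg_trans hn _; rewrite leg_rat // ler_nat leq_maxl.
  by apply: leg_trans le _; rewrite leg_rat // ler_nat leq_maxr.
(* The integer [n.+1] has no Right options, so only the Left options of [G] matter, and these are at
   most [n]. *)
exists n.+1; apply/legP; split=> K hK.
  apply/negP => le; move: (leg_trans le (hn _ hK)).
  by rewrite leg_rat // ler_nat ltnn.
by move: hK; rewrite (rat_game_int n.+1).
Qed.

Lemma leg_int_lb (G : game) : exists n : nat, leg (rat_game (- n%:R)) G.
Proof.
elim/game_option_ind: G => G _ IHR.
have Dn (n : nat) : dyadics (- n%:R).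
  by have := int_dyadic (- n%:Z); rewrite mulrNz.
have [n hn] : exists n : nat,
    {in ropts G, forall GR, leg (rat_game (- n%:R)) GR}.
  elim: (ropts G) IHR => [|K s IHs] IHR; first by exists 0%N.
  have [n hn] := IHR K (mem_head K s).
  have [|m hm] := IHs; first by move=> L Ls; apply: IHR; rewrite inE Ls orbT.
  exists (maxn n m) => L; rewrite inE => /orP[/eqP->|/hm le].
    by apply: leg_trans hn; rewrite leg_rat // lerN2 ler_nat leq_maxl.
  by apply: leg_trans le; rewrite leg_rat // lerN2 ler_nat leq_maxr.
exists n.+1; apply/legP; split=> K hK; last first.
  apply/negP => le; move: (leg_trans (hn _ hK) le).
  by rewrite leg_rat // lerN2 ler_nat ltnn.
move: hK; have -> : - n.+1%:R = (- n.+1%:Z)%:~R :> rat by rewrite mulrNz.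
by rewrite rat_game_int int_game_neg.
Qed.

(** * The simplicity theorem *)

Section Stops.

Variable A : set rat.
Hypothesis hA : A = integers \/ A = dyadics.

Let num_lopt := num_lopt hA.
Let num_ropt := num_ropt hA.
Let num_dyadic := num_dyadic hA.

Lemma leg_num (a b : rat) : A a -> A b ->
  leg (rat_game a) (rat_game b) = (a <= b).
Proof. by move=> /num_dyadic Da /num_dyadic Db; apply: leg_rat. Qed.

(* Descending to an option of [x] which still fits, one may assume that no
   option fits; then [H] equals [x]. *)
Lemma simplicity (H : game) (x : rat) : A x ->
  {in lopts H, forall HL, ~~ leg (rat_game x) HL} ->
  {in ropts H, forall HR, ~~ leg HR (rat_game x)} -> in_num A H.
Proof.
move: {2}(rat_game x) (erefl (rat_game x)) => X; elim/game_option_ind: X x.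
move=> X IHL IHR x eX Ax hL hR; apply: contrapT => nH.
suff eHx : eqg H (rat_game x) by apply: nH; exists x.
apply/andP; split; apply/legP; split=> // K hK; apply/negP => le.
- have [a [Aa xa eK]] := num_ropt Ax hK.
  apply: nH; apply: (IHR K _ a) => //; rewrite -?eX // -eK => O hO.
    apply/negP => leO; move: (hL _ hO); apply/negP; rewrite negbK.
    by apply: leg_trans leO; rewrite eK leg_num // ltW.
  exact: leg_ropt le hO.
- have [a [Aa ax eK]] := num_lopt Ax hK.
  apply: nH; apply: (IHL K _ a) => //; rewrite -?eX // -eK => O hO.
    exact: leg_lopt le hO.
  apply/negP => leO; move: (hR _ hO); apply/negP; rewrite negbK.
  by apply: leg_trans leO _; rewrite eK leg_num // ltW.
Qed.

(** Without Left options, any integer below [G] fits: no Right option of [G] is at or below it.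
    Simplicity then puts [G] in [A]. *)
Lemma lopts_neq0 (G : game) : ~ in_num A G -> lopts G != [::].
Proof.
move=> nG; apply/negP => /eqP G0; have [n le] := leg_int_lb G; apply: nG.
apply: (@simplicity _ (- n%:R)) => [|K|K hK]; last exact: leg_ropt le hK.
- by have := int_num hA (- n%:Z); rewrite mulrNz.
- by rewrite G0.
Qed.

Lemma ropts_neq0 (G : game) : ~ in_num A G -> ropts G != [::].
Proof.
move=> nG; apply/negP => /eqP G0; have [n le] := leg_int_ub G; apply: nG.
apply: (@simplicity _ n%:R) => [|K hK|K]; first exact: int_num hA n.
- exact: leg_lopt le hK.
- by rewrite G0.
Qed.

(** * Stops, and comparison with numbers through them *)

Lemma seq_max_ge (s : seq rat) (x : rat) : x \in s -> x <= seq_max s.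
Proof. by move=> xs; apply: le_bigmax_seq. Qed.

Lemma seq_min_le (s : seq rat) (x : rat) : x \in s -> seq_min s <= x.
Proof. by move=> xs; apply: ge_bigmin_seq. Qed.

(** The fold starts from the head of the list, so every partial maximum is an entry. *)
Lemma seq_max_mem (s : seq rat) : s != [::] -> seq_max s \in s.
Proof.
case: s => // x s _; rewrite /seq_max /= big_seq.
apply: (big_ind (fun z => z \in x :: s)) => // [|y z ys zs].
  exact: mem_head.
by rewrite /Num.max; case: ifP.
Qed.

Lemma seq_min_mem (s : seq rat) : s != [::] -> seq_min s \in s.
Proof.
case: s => // x s _; rewrite /seq_min /= big_seq.
apply: (big_ind (fun z => z \in x :: s)) => // [|y z ys zs].
  exact: mem_head.
by rewrite /Num.min; case: ifP.
Qed.

Lemma stops_num (G : game) : in_num A G ->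
  [/\ A (LS A G), RS A G = LS A G & eqg G (rat_game (LS A G))].
Proof.
move=> nG; have -> : LS A G = num_value A G.
  by case: G nG => Ls Rs nG; rewrite /LS /= asboolT.
have -> : RS A G = num_value A G.
  by case: G nG => Ls Rs nG; rewrite /RS /= asboolT.
case: nG => a Aa Ga; rewrite /num_value; case: xgetP => [b _ [Ab Gb] //|].
by move/(_ a); case.
Qed.

Lemma LSE (G : game) : ~ in_num A G ->
  LS A G = seq_max [seq RS A GL | GL <- lopts G].
Proof. by case: G => Ls Rs nG; rewrite /LS /= asboolF. Qed.

Lemma RSE (G : game) : ~ in_num A G ->
  RS A G = seq_min [seq LS A GR | GR <- ropts G].
Proof. by case: G => Ls Rs nG; rewrite /RS /= asboolF. Qed.

Lemma LS_ub (G GL : game) : ~ in_num A G -> GL \in lopts G ->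
  RS A GL <= LS A G.
Proof. by move=> nG hL; rewrite LSE //; apply/seq_max_ge/map_f. Qed.

Lemma RS_lb (G GR : game) : ~ in_num A G -> GR \in ropts G ->
  RS A G <= LS A GR.
Proof. by move=> nG hR; rewrite RSE //; apply/seq_min_le/map_f. Qed.

Lemma LS_attained (G : game) : ~ in_num A G ->
  exists2 GL, GL \in lopts G & LS A G = RS A GL.
Proof.
move=> nG; rewrite LSE //; apply/mapP/seq_max_mem.
by move: (lopts_neq0 nG); case: lopts.
Qed.

Lemma RS_attained (G : game) : ~ in_num A G ->
  exists2 GR, GR \in ropts G & RS A G = LS A GR.
Proof.
move=> nG; rewrite RSE //; apply/mapP/seq_min_mem.
by move: (ropts_neq0 nG); case: ropts.
Qed.

Lemma stops_in (G : game) : A (LS A G) /\ A (RS A G).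
Proof.
elim/game_option_ind: G => G IHL IHR.
have [/stops_num[AL -> _] //|nG] := pselect (in_num A G).
have [GL /IHL[_ AL] ->] := LS_attained nG.
by have [GR /IHR[AR _] ->] := RS_attained nG.
Qed.

(* Besides the elements of A themselves, this covers n + 1/2 for A the set of
   integers: such half-integers separate the integer stops. *)
Definition options_in (y : rat) : Prop :=
  [/\ dyadics y,
      {in lopts (rat_game y), forall YL,
         exists a, [/\ A a, a < y & YL = rat_game a]} &
      {in ropts (rat_game y), forall YR,
         exists a, [/\ A a, y < a & YR = rat_game a]}].

Lemma num_options_in (x : rat) : A x -> options_in x.
Proof.
move=> Ax; split=> [|K|K]; first exact: num_dyadic.
- exact: num_lopt.
- exact: num_ropt.
Qed.

(** The four parts need a joint induction, because Left stops come from Right stops of options and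
    conversely. *)
Lemma leg_stops (y : rat) (G : game) : options_in y ->
  [/\ y < RS A G -> leg (rat_game y) G,
      y < LS A G -> ~~ leg G (rat_game y),
      RS A G < y -> ~~ leg (rat_game y) G &
      LS A G < y -> leg G (rat_game y)].
Proof.
case=> Dy yL yR; elim/game_option_ind: G => G IHL IHR.
have [/stops_num[AL -> /andP[le ge]]|nG] := pselect (in_num A G).
  have DL := num_dyadic AL; split=> lt.
  - by apply: leg_trans ge; rewrite leg_rat // ltW.
  - by apply/negP => /(leg_trans ge); rewrite leg_rat // leNgt lt.
  - by apply/negP => /leg_trans/(_ le); rewrite leg_rat // leNgt lt.
  - by apply: leg_trans le _; rewrite leg_rat // ltW.
split=> lt.
- have hR : {in ropts G, forall GR, ~~ leg GR (rat_game y)}.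
    move=> K hK; have [_ h _ _] := IHR _ hK.
    exact/h/(lt_le_trans lt)/RS_lb.
  (* If a Left option [a] of [y] were above [G], then [a], an element of [A], would fit between the
     options of [G], and simplicity would put [G] in [A]. *)
  apply/legP; split=> // YL hYL; apply/negP => le.
  have [a [Aa ay ea]] := yL _ hYL.
  apply: nG; apply: (simplicity Aa); rewrite -ea => K hK.
    exact: leg_lopt le hK.
  apply/negP => leK; move: (hR _ hK); apply/negP; rewrite negbK.
  by apply: leg_trans leK _; rewrite ea leg_rat ?ltW //; apply: num_dyadic.
- have [GL hL eL] := LS_attained nG; apply/negP => /leg_lopt/(_ hL).
  by have [-> //] := IHL _ hL; rewrite -eL.
- have [GR hR eR] := RS_attained nG; apply/negP => /leg_ropt/(_ hR).
  by have [_ _ _ -> //] := IHR _ hR; rewrite -eR.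
- have hL : {in lopts G, forall GL, ~~ leg (rat_game y) GL}.
    move=> K hK; have [_ _ h _] := IHL _ hK.
    by apply/h/(le_lt_trans _ lt)/LS_ub.
  apply/legP; split=> // YR hYR; apply/negP => le.
  have [a [Aa ya ea]] := yR _ hYR.
  apply: nG; apply: (simplicity Aa); rewrite -ea => K hK; last first.
    exact: leg_ropt le hK.
  apply/negP => leK; move: (hL _ hK); apply/negP; rewrite negbK.
  by apply: leg_trans leK; rewrite ea leg_rat ?ltW //; apply: num_dyadic.
Qed.

(** For the integers the half-integer just above [a] serves, its canonical options being integers;
    for the dyadics the midpoint serves. *)
Lemma num_between (a b : rat) : A a -> A b -> a < b ->
  exists y, options_in y /\ a < y < b.
Proof.
case: hA => eA; rewrite {1 2}eA.
  move=> [n ->] [m ->]; rewrite ltr_int => lt_nm.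
  exists ((2 * n + 1)%:~R / 2 ^+ 1); have := dyadic_lt_step n 0.
  rewrite expr0 !divr1 => /andP[lt_ny lt_yn]; split.
    split=> [|K|K]; first by exists (2 * n + 1), 1%N.
      rewrite rat_game_odd inE expr0 divr1 => /eqP ->; exists n%:~R.
      by split=> //; apply: int_num.
    rewrite rat_game_odd inE expr0 divr1 => /eqP ->; exists (n + 1)%:~R.
    by split=> //; apply: int_num.
  by rewrite lt_ny /= (lt_le_trans lt_yn) // ler_int; lia.
move=> [m [k ->]] [n [l ->]] lt; have [d ed] := dyadic_lift m (leq_addr l k).
have [e ee] := dyadic_lift n (leq_addl k l); rewrite {}ed {}ee in lt *.
exists ((d + e)%:~R / 2 ^+ (k + l).+1); split.
  by apply: num_options_in; rewrite eA; exists (d + e), (k + l).+1.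
move: lt; rewrite exprS invfM intrD -subr_gt0 -mulrBl.
rewrite pmulr_lgt0 ?invr_gt0 ?exprn_gt0 // subr_gt0 => lt.
have h : 0 < (2 ^+ (k + l) : rat)^-1 by rewrite invr_gt0 exprn_gt0.
by apply/andP; split; nra.
Qed.

(** * Switches outside [A], compared with their own stops *)

(** Settles the boundary case [RS A H = x] that [leg_stops] leaves open. *)
Lemma switch_RS (H : game) (x : rat) : in_switch A H -> ~ in_num A H ->
  A x -> RS A H <= x -> ~~ leg (rat_game x) H.
Proof.
case=> a [b [Aa Ab eH]] nH Ax le_x; apply/negP => xH.
have /andP[leHab leabH] := eH.
have xb : x < b.
  have := leg_ropt (leg_trans xH leHab) (mem_head _ _).
  by rewrite leg_num // -ltNge.
have [y [oy /andP[xy yb]]] := num_between Ax Ab xb.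
have [_ _ + _] := leg_stops H oy; case/(_ (le_lt_trans le_x xy))/negP.
(* It remains to see that [y] is below [{a | b}]. A Left option [c] of [y] above [{a | b}] would
   satisfy [c < y < b] and so fit there, putting [H] in [A]. *)
apply: leg_trans leabH; have [Dy yL _] := oy; apply/legP; split=> K.
  move=> /yL[c [Ac cy ->]]; apply/negP => le; apply: nH.
  have [L hL|L hL|z Az ez] :=
      @simplicity (Game [:: rat_game a] [:: rat_game b]) c Ac.
  - exact: leg_lopt le hL.
  - move: hL; rewrite inE => /eqP ->.
    by rewrite leg_num // -ltNge; apply: lt_trans yb.
  - by exists z; rewrite // (eqg_trans eH ez).
by rewrite inE => /eqP ->; rewrite leg_rat -?ltNge //; apply: num_dyadic.
Qed.

(** Mirror image of [switch_RS], with [y] strictly between [a] and [x]. *)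
Lemma switch_LS (H : game) (x : rat) : in_switch A H -> ~ in_num A H ->
  A x -> x <= LS A H -> ~~ leg H (rat_game x).
Proof.
case=> a [b [Aa Ab eH]] nH Ax x_le; apply/negP => Hx.
have /andP[leHab leabH] := eH.
have ax : a < x.
  have := leg_lopt (leg_trans leabH Hx) (mem_head _ _).
  by rewrite leg_num // -ltNge.
have [y [oy /andP[ay yx]]] := num_between Aa Ax ax.
have [_ + _ _] := leg_stops H oy; case/(_ (lt_le_trans yx x_le))/negP.
apply: leg_trans leHab _; have [Dy _ yR] := oy.
apply/legP; split=> K; last first.
  move=> /yR[c [Ac yc ->]]; apply/negP => le; apply: nH.
  have [L hL|L hL|z Az ez] :=
      @simplicity (Game [:: rat_game a] [:: rat_game b]) c Ac.
  - move: hL; rewrite inE => /eqP ->.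
    by rewrite leg_num // -ltNge; apply: lt_trans yc.
  - exact: leg_ropt le hL.
  - by exists z; rewrite // (eqg_trans eH ez).
by rewrite inE => /eqP ->; rewrite leg_rat -?ltNge //; apply: num_dyadic.
Qed.

(** * Numbers, and games with all options in [A], as switches *)

Lemma num_switch (G : game) : in_num A G -> in_switch A G.
Proof.
case=> x Ax eG; suff [a [b [Aa Ab e]]] : in_switch A (rat_game x).
  by exists a, b; rewrite (eqg_trans eG e).
have [[n ->]|[eA [m [k ->]]]] := num_cases hA Ax; last first.
  exists (m%:~R / 2 ^+ k), ((m + 1)%:~R / 2 ^+ k); rewrite eA.
  split; [by exists m, k | by exists (m + 1), k |].
  by rewrite rat_game_odd /eqg leg_refl.
(* The canonical form of [n] has at most one option; supplying the missing ones among [n - 1] and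
   [n + 1] does not change the value. *)
exists (n - 1)%:~R, (n + 1)%:~R; split; try exact: int_num.
apply/andP; split; apply/legP; split=> K.
- rewrite rat_game_int => /int_game_lopt[_ ->]; rewrite -rat_game_int.
  exact/lopt_nle/mem_head.
- rewrite inE => /eqP ->; rewrite leg_num ?ler_int; try exact: int_num.
  by lia.
- rewrite inE => /eqP ->; rewrite leg_num ?ler_int; try exact: int_num.
  by lia.
- rewrite rat_game_int => /int_game_ropt[_ ->]; rewrite -rat_game_int.
  exact/ropt_nle/mem_head.
Qed.

(** Supplies the dominating Left option. Its value [a] is carried along so that options are compared
    as rationals. *)
Lemma num_max (s : seq game) : s != [::] -> {in s, forall K, in_num A K} ->
  exists K a, [/\ K \in s, A a, eqg K (rat_game a) &
                 {in s, forall L, leg L (rat_game a)}].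
Proof.
elim: s => // K [|K' s] IHs _ hs; have [a Aa eK] := hs K (mem_head _ _).
  have /andP[le _] := eK.
  by exists K, a; rewrite mem_head; split=> // L; rewrite inE => /eqP ->.
have [//|L hL|L [b [hL Ab eL lb]]] := IHs.
  by apply: hs; rewrite inE hL orbT.
have /andP[leK _] := eK; case: (leP a b) => ab.
  exists L, b; rewrite inE hL orbT; split=> // M.
  rewrite inE => /orP[/eqP->|/lb //].
  by apply: leg_trans leK _; rewrite leg_num.
exists K, a; rewrite mem_head; split=> // M.
rewrite inE => /orP[/eqP-> //|/lb le].
by apply: leg_trans le _; rewrite leg_num // ltW.
Qed.

Lemma num_min (s : seq game) : s != [::] -> {in s, forall K, in_num A K} ->
  exists K a, [/\ K \in s, A a, eqg K (rat_game a) &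
                 {in s, forall L, leg (rat_game a) L}].
Proof.
elim: s => // K [|K' s] IHs _ hs; have [a Aa eK] := hs K (mem_head _ _).
  have /andP[_ le] := eK.
  by exists K, a; rewrite mem_head; split=> // L; rewrite inE => /eqP ->.
have [//|L hL|L [b [hL Ab eL lb]]] := IHs.
  by apply: hs; rewrite inE hL orbT.
have /andP[_ leK] := eK; case: (leP b a) => ba.
  exists L, b; rewrite inE hL orbT; split=> // M.
  rewrite inE => /orP[/eqP->|/lb //].
  by apply: leg_trans leK; rewrite leg_num.
exists K, a; rewrite mem_head; split=> // M.
rewrite inE => /orP[/eqP-> //|/lb le].
by apply: leg_trans le; rewrite leg_num // ltW.
Qed.

(** Outside [A] both option lists are nonempty, and deleting dominated options leaves the largest
    Left and the smallest Right one. *)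
Lemma num_options_switch (G : game) : {in lopts G, forall GL, in_num A GL} ->
  {in ropts G, forall GR, in_num A GR} -> in_switch A G.
Proof.
move=> hL hR; have [/num_switch //|nG] := pselect (in_num A G).
have [K [a [hK Aa /andP[Ka aK] maxa]]] := num_max (lopts_neq0 nG) hL.
have [L [b [hL' Ab /andP[Lb bL] minb]]] := num_min (ropts_neq0 nG) hR.
exists a, b; split=> //; apply/andP; split; apply: leg_dominated => M.
- by move/maxa => le; exists (rat_game a); rewrite ?mem_head.
- by rewrite inE => /eqP ->; exists L.
- by rewrite inE => /eqP ->; exists K.
- by move/minb => le; exists (rat_game b); rewrite ?mem_head.
Qed.

(** * Guide options and the diamond property *)

(** The guide option bounds [LS A G] by [x], and [LS A G] bounds the Right stop of every Left
    option. *)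
Lemma gdL_fits (G GL : game) (x : rat) : ~ in_num A G ->
  {in lopts G, forall K, in_switch A K} -> A x ->
  GL \in gdL A G -> ~~ leg (rat_game x) GL ->
  {in lopts G, forall K, ~~ leg (rat_game x) K}.
Proof.
move=> nG hsw Ax; have [AL _] := stops_in G; have ox := num_options_in Ax.
rewrite /gdL asboolF //; case: ifPn => [_|/hasPn nhas].
  (* Here [GL] equals the Left stop, so [LS A G < x] strictly and [leg_stops] decides for every
     [K]. *)
  rewrite mem_filter => /andP[/andP[le ge] hGL] nle K hK.
  have [_ _ h _] := leg_stops K ox; apply: h.
  apply: le_lt_trans (LS_ub nG hK) _; rewrite ltNge -leg_num //.
  by apply: contra nle => /leg_trans; apply.
rewrite mem_filter => /andP[/eqP eGL hGL] nle K hK.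
have Lx : LS A G <= x.
  have [h _ _ _] := leg_stops GL ox.
  by rewrite leNgt -eGL; apply: contra nle.
(* Only [LS A G <= x] is known now, so the Right stop of [K] may equal [x]; for [K] outside [A] this
   is the case of [switch_RS]. *)
have [nK|nK] := pselect (in_num A K); last first.
  by apply: switch_RS (hsw _ hK) nK Ax _; apply: le_trans (LS_ub nG hK) Lx.
(* For [K] in [A] the Right stop is its value, which differs from [LS A G] because no Left option
   equals that stop; hence it is strictly below [x]. *)
have [AK eRS eK] := stops_num nK.
have [_ _ h _] := leg_stops K ox; apply: h; apply: lt_le_trans Lx.
rewrite lt_neqAle LS_ub // andbT; apply: contra (nhas _ hK) => /eqP <-.
by rewrite eRS.
Qed.

(** Mirror image of [gdL_fits], through [switch_LS]. *)
Lemma gdR_fits (G GR : game) (x : rat) : ~ in_num A G ->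
  {in ropts G, forall K, in_switch A K} -> A x ->
  GR \in gdR A G -> ~~ leg GR (rat_game x) ->
  {in ropts G, forall K, ~~ leg K (rat_game x)}.
Proof.
move=> nG hsw Ax; have [_ AR] := stops_in G; have ox := num_options_in Ax.
rewrite /gdR asboolF //; case: ifPn => [_|/hasPn nhas].
  rewrite mem_filter => /andP[/andP[le ge] hGR] nle K hK.
  have [_ h _ _] := leg_stops K ox; apply: h.
  apply: lt_le_trans (RS_lb nG hK); rewrite ltNge -leg_num //.
  by apply: contra nle; apply: leg_trans.
rewrite mem_filter => /andP[/eqP eGR hGR] nle K hK.
have xR : x <= RS A G.
  have [_ _ _ h] := leg_stops GR ox.
  by rewrite leNgt -eGR; apply: contra nle.
have [nK|nK] := pselect (in_num A K); last first.
  by apply: switch_LS (hsw _ hK) nK Ax _; apply: le_trans xR (RS_lb nG hK).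
have [AK eRS eK] := stops_num nK.
have [_ h _ _] := leg_stops K ox; apply: h; apply: le_lt_trans xR _.
rewrite lt_neqAle RS_lb // andbT; apply: contra (nhas _ hK) => /eqP ->.
by [].
Qed.

Lemma diamond_num (G : game) : {in lopts G, forall K, in_switch A K} ->
  {in ropts G, forall K, in_switch A K} -> diamond A G -> in_num A G.
Proof.
move=> hL hR [//|[GL [GR [x [hGL hGR Ax]]]]]; rewrite !ngegE => nL nR.
apply: contrapT => nG; apply: (nG); apply: (simplicity Ax).
- exact: gdL_fits hGL nL.
- exact: gdR_fits hGR nR.
Qed.

End Stops.

Unset Implicit Arguments.

Theorem theorem1 (A : set rat) (hA : A = integers \/ A = dyadics)
    (P D S : set game)
    (P_closed : option_closed P)
    (P_cover : P = D `|` S) (DS_disjoint : D `&` S = set0)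
    (D_diamond : forall G, D G -> diamond A G)
    (S_options : forall G, S G ->
       (forall GL, GL \in lopts G -> D GL) /\
       (forall GR, GR \in ropts G -> D GR)) :
  (forall G, P G -> in_switch A G) /\ (forall G, D G -> in_num A G).
Proof.
(* The two claims feed each other: a game in [D] needs its options to be switches, a game in [S]
   needs its options to lie in [A]. *)
have main G : (P G -> in_switch A G) /\ (D G -> in_num A G).
  elim/game_option_ind: G => G IHL IHR.
  have DA : D G -> in_num A G.
    move=> DG; have [|PL PR] := P_closed G; first by rewrite P_cover; left.
    apply: (diamond_num hA) (D_diamond _ DG) => K hK.
    - by have [h _] := IHL _ hK; apply/h/PL.
    - by have [h _] := IHR _ hK; apply/h/PR.
  split=> //; rewrite P_cover => -[/DA/(num_switch hA) //|/S_options[DL DR]].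
  apply: (num_options_switch hA) => K hK.
  - by have [_ h] := IHL _ hK; apply/h/DL.
  - by have [_ h] := IHR _ hK; apply/h/DR.
by split=> G; have [] := main G.
Qed.
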